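(* Let $E$ be an arbitrary directed graph, $K$ a field, $L=L_K(E)$, and let $p$ be an infinite path in $E$. Then the Chen simple left $L$-module $V_{[p]}$ is a graded-simple $L$-module (that is, there is a $\mathbb{Z}$-grading on $V_{[p]}$ making it a graded left $L$-module whose only graded submodules are $0$ and itself) if and only if $p$ is an irrational infinite path, in which case $p$ is a homogeneous element of $V_{[p]}$ (with respect to any such grading).
   Context: A directed graph $E=(E^0,E^1,r,s)$ has vertex set $E^0$, edge set $E^1$ and range/source maps $r,s$; no cardinality restriction is made. A vertex is regular if it emits a nonempty finite set of edges. $L_K(E)$ is the (not necessarily unital) $K$-algebra generated by pairwise orthogonal idempotents $v\in E^0$ and elements $e,e^*$ ($e\in E^1$) subject to: $s(e)e=e=er(e)$; $r(e)e^*=e^*=e^*s(e)$; $e^*e=r(e)$ and $e^*f=0$ for $e\ne f$; $v=\sum_{s(e)=v}ee^*$ for each regular vertex $v$. It is $\mathbb{Z}$-graded by $\deg v=0$, $\deg e=1$, $\deg e^*=-1$. A left $L$-module $M$ is graded if $M=\bigoplus_{n\in\mathbb{Z}}M_n$ with $L_mM_n\subseteq M_{m+n}$. An infinite path is a sequence $p=e_1e_2e_3\cdots$ of edges with $r(e_i)=s(e_{i+1})$; $\tau^{>n}(p)=e_{n+1}e_{n+2}\cdots$. Infinite paths $p,q$ are tail-equivalent if $\tau^{>m}(p)=\tau^{>n}(q)$ for some positive integers $m,n$; $[p]$ is the tail-equivalence class of $p$. An infinite path is rational if it is tail-equivalent to $ccc\cdots$ for some closed path $c$ (a path of positive length with equal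 source and range), and irrational otherwise. $V_{[p]}$ is the $K$-vector space with basis $[p]$, with left $L$-action determined, for $q\in[p]$, $v\in E^0$, $e\in E^1$, by: $v\cdot q=q$ if $s(q)=v$ and $0$ otherwise; $e\cdot q=eq$ if $s(q)=r(e)$ and $0$ otherwise; $e^*\cdot q=q'$ if $q=eq'$ and $0$ otherwise. (It is known to be a simple $L$-module.) *)

(* Defs.v *)
From HB Require Import structures.
From mathcomp Require Import all_boot all_order all_algebra.
From mathcomp Require Import boolp classical_sets.
From mathcomp Require Import finmap.
From mathcomp.multinomials Require Import monalg.

Set Implicit Arguments.
Unset Strict Implicit.
Unset Printing Implicit Defensive.

Import GRing.Theory.
Local Open Scope classical_set_scope.
Local Open Scope ring_scope.

(* Not necessarily unital associative algebras over a commutative ring K, and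
   left modules over them.  Unitality (A V = V) is not required of modules. *)

HB.mixin Record Lmodule_isNuAlgebra (K : comNzRingType) A
    of GRing.Lmodule K A := {
  numul : A -> A -> A;
  numulA : associative numul;
  numulDl : left_distributive numul +%R;
  numulDr : right_distributive numul +%R;
  nuscaleAl : forall k a b, k *: numul a b = numul (k *: a) b;
  nuscaleAr : forall k a b, k *: numul a b = numul a (k *: b);
}.

#[short(type="nuAlgType")]
HB.structure Definition NuAlgebra (K : comNzRingType) :=
  {A of Lmodule_isNuAlgebra K A & GRing.Lmodule K A}.

HB.mixin Record Lmodule_isNuModule (K : comNzRingType) (A : nuAlgType K) V
    of GRing.Lmodule K V := {
  nuact : A -> V -> V;
  nuactA : forall a b x, nuact (numul a b) x = nuact a (nuact b x);
  nuactDl : forall a b x, nuact (a + b) x = nuact a x + nuact b x;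
  nuactDr : forall a x y, nuact a (x + y) = nuact a x + nuact a y;
  nuactZl : forall k a x, nuact (k *: a) x = k *: nuact a x;
  nuactZr : forall k a x, nuact a (k *: x) = k *: nuact a x;
}.

#[short(type="nuModType")]
HB.structure Definition NuModule (K : comNzRingType) (A : nuAlgType K) :=
  {V of Lmodule_isNuModule K A V & GRing.Lmodule K V}.

Section GradedModules.
Context (K : comNzRingType) (A : nuAlgType K) (V : nuModType A).

Definition add_subgroup (N : set V) :=
  N 0 /\ forall x y, N x -> N y -> N (x - y).

Definition is_submodule (N : set V) :=
  add_subgroup N /\ forall (a : A) x, N x -> N (nuact a x).

(* N is the internal direct sum of the additive subgroups (M n), n : int. *)
Definition internal_direct_sum (N : set V) (M : int -> set V) :=
  [/\ forall n, add_subgroup (M n) /\ M n `<=` N,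
      forall x, N x -> exists (s : seq int) (c : int -> V),
        (forall n, M n (c n)) /\ x = \sum_(n <- s) c n
    & forall (s : seq int) (c : int -> V), uniq s ->
        (forall n, M n (c n)) -> \sum_(n <- s) c n = 0 ->
        forall n, n \in s -> c n = 0].

Context (AG : int -> set A).

Definition module_grading (M : int -> set V) :=
  internal_direct_sum setT M /\
  forall m n a x, AG m a -> M n x -> M (m + n) (nuact a x).

Definition graded_submodule (M : int -> set V) (N : set V) :=
  is_submodule N /\ internal_direct_sum N (fun n => N `&` M n).

Definition graded_simple (M : int -> set V) :=
  module_grading M /\
  forall N, graded_submodule M N -> N = [set 0] \/ N = setT.

Definition homogeneous (M : int -> set V) (x : V) := exists n, M n x.

End GradedModules.

(* The not necessarily unital K-algebra generated by a type X of symbols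
   subject to a family R of relations: formal expressions modulo the smallest
   congruence that contains R and the algebra axioms. *)

Section Presentation.
Context (K : comNzRingType) (X : Type).

Inductive nuterm : Type :=
| TGen of X
| TZero
| TAdd of nuterm & nuterm
| TOpp of nuterm
| TScale of K & nuterm
| TMul of nuterm & nuterm.

Definition tsum (s : seq nuterm) : nuterm := foldr TAdd TZero s.

HB.instance Definition _ := gen_eqMixin nuterm.
HB.instance Definition _ := gen_choiceMixin nuterm.

Context (R : nuterm -> nuterm -> Prop).

Inductive nucongr : nuterm -> nuterm -> Prop :=
| nucongr_rel t u of R t u : nucongr t u
| nucongr_refl t : nucongr t t
| nucongr_sym t u of nucongr t u : nucongr u t
| nucongr_trans t u w of nucongr t u & nucongr u w : nucongr t w
| nucongr_add t t' u u' of nucongr t t' & nucongr u u' :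
    nucongr (TAdd t u) (TAdd t' u')
| nucongr_opp t t' of nucongr t t' : nucongr (TOpp t) (TOpp t')
| nucongr_scale k t t' of nucongr t t' : nucongr (TScale k t) (TScale k t')
| nucongr_mul t t' u u' of nucongr t t' & nucongr u u' :
    nucongr (TMul t u) (TMul t' u')
| nucongr_addA t u w : nucongr (TAdd t (TAdd u w)) (TAdd (TAdd t u) w)
| nucongr_addC t u : nucongr (TAdd t u) (TAdd u t)
| nucongr_add0 t : nucongr (TAdd TZero t) t
| nucongr_addN t : nucongr (TAdd (TOpp t) t) TZero
| nucongr_scaleA k l t : nucongr (TScale k (TScale l t)) (TScale (k * l) t)
| nucongr_scale1 t : nucongr (TScale 1 t) t
| nucongr_scaleDr k t u :
    nucongr (TScale k (TAdd t u)) (TAdd (TScale k t) (TScale k u))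
| nucongr_scaleDl k l t :
    nucongr (TScale (k + l) t) (TAdd (TScale k t) (TScale l t))
| nucongr_mulA t u w : nucongr (TMul t (TMul u w)) (TMul (TMul t u) w)
| nucongr_mulDl t u w :
    nucongr (TMul (TAdd t u) w) (TAdd (TMul t w) (TMul u w))
| nucongr_mulDr t u w :
    nucongr (TMul t (TAdd u w)) (TAdd (TMul t u) (TMul t w))
| nucongr_scaleAl k t u : nucongr (TScale k (TMul t u)) (TMul (TScale k t) u)
| nucongr_scaleAr k t u : nucongr (TScale k (TMul t u)) (TMul t (TScale k u)).

Definition nucongrb (t u : nuterm) : bool := `[< nucongr t u >].

Lemma nucongrb_refl : reflexive nucongrb.
Proof. by move=> t; apply/asboolP; apply: nucongr_refl. Qed.

Lemma nucongrb_sym : symmetric nucongrb.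
Proof.
by move=> t u; apply/asboolP/asboolP; apply: nucongr_sym.
Qed.

Lemma nucongrb_trans : transitive nucongrb.
Proof.
by move=> u t w /asboolP tu /asboolP uw; apply/asboolP; apply: nucongr_trans uw.
Qed.

Canonical nucongr_equiv :=
  EquivRel nucongrb nucongrb_refl nucongrb_sym nucongrb_trans.

Definition presented : Type := {eq_quot nucongr_equiv}%qT.

HB.instance Definition _ := Choice.on presented.

Definition pclass (t : nuterm) : presented := (\pi_{eq_quot nucongr_equiv} t)%qT.
Definition prepr (a : presented) : nuterm :=
  repr (a : {eq_quot nucongr_equiv}%qT).

Lemma preprK : cancel prepr pclass.
Proof. by move=> a; rewrite /pclass /prepr reprK. Qed.

Lemma pclassP t u : pclass t = pclass u <-> nucongr t u.
Proof.
split=> [/eqmodP/asboolP //|tu].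
by apply/eqmodP/asboolP.
Qed.

Lemma prepr_pclass t : nucongr (prepr (pclass t)) t.
Proof. by apply/pclassP; rewrite preprK. Qed.

Definition padd (a b : presented) := pclass (TAdd (prepr a) (prepr b)).
Definition popp (a : presented) := pclass (TOpp (prepr a)).
Definition pscale (k : K) (a : presented) := pclass (TScale k (prepr a)).
Definition pmul (a b : presented) := pclass (TMul (prepr a) (prepr b)).

Lemma pclass_add t u : padd (pclass t) (pclass u) = pclass (TAdd t u).
Proof. by apply/pclassP; apply: nucongr_add; apply: prepr_pclass. Qed.

Lemma pclass_opp t : popp (pclass t) = pclass (TOpp t).
Proof. by apply/pclassP; apply: nucongr_opp; apply: prepr_pclass. Qed.

Lemma pclass_scale k t : pscale k (pclass t) = pclass (TScale k t).
Proof. by apply/pclassP; apply: nucongr_scale; apply: prepr_pclass. Qed.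

Lemma pclass_mul t u : pmul (pclass t) (pclass u) = pclass (TMul t u).
Proof. by apply/pclassP; apply: nucongr_mul; apply: prepr_pclass. Qed.

Let pE := (pclass_add, pclass_opp, pclass_scale, pclass_mul).

Lemma paddA : associative padd.
Proof.
move=> a b c; rewrite -(preprK a) -(preprK b) -(preprK c) !pE.
by apply/pclassP; apply: nucongr_addA.
Qed.

Lemma paddC : commutative padd.
Proof. by move=> a b; apply/pclassP; apply: nucongr_addC. Qed.

Lemma padd0 : left_id (pclass TZero) padd.
Proof.
by move=> a; rewrite -(preprK a) !pE; apply/pclassP; apply: nucongr_add0.
Qed.

Lemma paddN : left_inverse (pclass TZero) popp padd.
Proof.
by move=> a; rewrite -(preprK a) !pE; apply/pclassP; apply: nucongr_addN.
Qed.

HB.instance Definition _ :=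
  GRing.isZmodule.Build presented paddA paddC padd0 paddN.

Lemma pscaleA k l a : pscale k (pscale l a) = pscale (k * l) a.
Proof.
by rewrite -(preprK a) !pE; apply/pclassP; apply: nucongr_scaleA.
Qed.

Lemma pscale1 : left_id 1 pscale.
Proof.
by move=> a; rewrite -(preprK a) !pE; apply/pclassP; apply: nucongr_scale1.
Qed.

Lemma pscaleDr : right_distributive pscale +%R.
Proof.
move=> k a b; rewrite /GRing.add /= -(preprK a) -(preprK b) !pE.
by apply/pclassP; apply: nucongr_scaleDr.
Qed.

Lemma pscaleDl a : {morph pscale^~ a : k l / k + l}.
Proof.
move=> k l; rewrite [RHS]/GRing.add /= -(preprK a) !pE.
by apply/pclassP; apply: nucongr_scaleDl.
Qed.

HB.instance Definition _ :=
  GRing.Zmodule_isLmodule.Build K presented pscaleA pscale1 pscaleDr pscaleDl.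

Lemma pmulA : associative pmul.
Proof.
move=> a b c; rewrite -(preprK a) -(preprK b) -(preprK c) !pE.
by apply/pclassP; apply: nucongr_mulA.
Qed.

Lemma pmulDl : left_distributive pmul +%R.
Proof.
move=> a b c; rewrite /GRing.add /= -(preprK a) -(preprK b) -(preprK c) !pE.
by apply/pclassP; apply: nucongr_mulDl.
Qed.

Lemma pmulDr : right_distributive pmul +%R.
Proof.
move=> a b c; rewrite /GRing.add /= -(preprK a) -(preprK b) -(preprK c) !pE.
by apply/pclassP; apply: nucongr_mulDr.
Qed.

Lemma pscaleAl k a b : k *: pmul a b = pmul (k *: a) b.
Proof.
rewrite /GRing.scale /= -(preprK a) -(preprK b) !pE.
by apply/pclassP; apply: nucongr_scaleAl.
Qed.

Lemma pscaleAr k a b : k *: pmul a b = pmul a (k *: b).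
Proof.
rewrite /GRing.scale /= -(preprK a) -(preprK b) !pE.
by apply/pclassP; apply: nucongr_scaleAr.
Qed.

HB.instance Definition _ :=
  Lmodule_isNuAlgebra.Build K presented pmulA pmulDl pmulDr pscaleAl pscaleAr.

Definition pgen (x : X) : presented := pclass (TGen x).

(* The K-span of the products of generators of total degree n. *)
Inductive homog_part (deg : X -> int) : int -> presented -> Prop :=
| homog_gen x : homog_part deg (deg x) (pgen x)
| homog_mul m n a b of homog_part deg m a & homog_part deg n b :
    homog_part deg (m + n) (numul a b)
| homog_zero n : homog_part deg n 0
| homog_add n a b of homog_part deg n a & homog_part deg n b :
    homog_part deg n (a + b)
| homog_scale n k a of homog_part deg n a : homog_part deg n (k *: a).

End Presentation.

Record digraph := Digraph {
  vertex : Type;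
  edge : Type;
  src : edge -> vertex;
  rng : edge -> vertex
}.

HB.instance Definition _ (E : digraph) := gen_eqMixin (vertex E).
HB.instance Definition _ (E : digraph) := gen_choiceMixin (vertex E).
HB.instance Definition _ (E : digraph) := gen_eqMixin (edge E).
HB.instance Definition _ (E : digraph) := gen_choiceMixin (edge E).

Section Leavitt.
Context (K : fieldType) (E : digraph).

Inductive leavitt_gen :=
| GVertex of vertex E
| GEdge of edge E
| GGhost of edge E.

Local Notation term := (nuterm K leavitt_gen).
Local Notation tv v := (TGen K (GVertex v) : term).
Local Notation te e := (TGen K (GEdge e) : term).
Local Notation tg e := (TGen K (GGhost e) : term).

(* s lists without repetition the edges emitted by v, and is nonempty; such an
   s exists precisely when v is a regular vertex. *)
Definition emits (v : vertex E) (s : seq (edge E)) :=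
  [/\ uniq s, s <> [::] & forall e, src e = v <-> e \in s].

Inductive leavitt_rel : term -> term -> Prop :=
| lrel_idem v : leavitt_rel (TMul (tv v) (tv v)) (tv v)
| lrel_orth v w of v <> w : leavitt_rel (TMul (tv v) (tv w)) (TZero _ _)
| lrel_se e : leavitt_rel (TMul (tv (src e)) (te e)) (te e)
| lrel_er e : leavitt_rel (TMul (te e) (tv (rng e))) (te e)
| lrel_rg e : leavitt_rel (TMul (tv (rng e)) (tg e)) (tg e)
| lrel_gs e : leavitt_rel (TMul (tg e) (tv (src e))) (tg e)
| lrel_ck1 e : leavitt_rel (TMul (tg e) (te e)) (tv (rng e))
| lrel_ck1' e f of e <> f : leavitt_rel (TMul (tg e) (te f)) (TZero _ _)
| lrel_ck2 v s of emits v s :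
    leavitt_rel (tv v) (tsum [seq TMul (te e) (tg e) | e <- s]).

Definition leavitt : Type := presented leavitt_rel.

HB.instance Definition _ := NuAlgebra.on leavitt.

Definition lvertex (v : vertex E) : leavitt := pgen leavitt_rel (GVertex v).
Definition ledge (e : edge E) : leavitt := pgen leavitt_rel (GEdge e).
Definition lghost (e : edge E) : leavitt := pgen leavitt_rel (GGhost e).

Definition leavitt_deg (g : leavitt_gen) : int :=
  match g with GVertex _ => 0 | GEdge _ => 1 | GGhost _ => -1 end.

Definition leavitt_grading (n : int) : set leavitt :=
  [set a | homog_part leavitt_deg n (a : presented leavitt_rel)].

End Leavitt.

Arguments leavitt_grading : clear implicits.

Section InfinitePaths.
Context (E : digraph).

(* Edges are numbered from 0: the path e_1 e_2 ... is i |-> e_(i+1). *)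
Record ipath := IPath {
  ipath_edge :> nat -> edge E;
  ipath_ok : forall i, rng (ipath_edge i) = src (ipath_edge i.+1)
}.

Lemma ipath_eqP (p q : ipath) : p = q <-> forall i, p i = q i.
Proof.
split=> [-> //|]; case: p q => [p hp] [q hq] /= pq.
have {}pq : p = q by apply/funext.
by subst q; congr IPath; apply: Prop_irrelevance.
Qed.

Definition isrc (p : ipath) : vertex E := src (p 0).

Definition tail (n : nat) (p : ipath) : ipath :=
  @IPath (fun i => p (i + n)%N) (fun i => ipath_ok p (i + n)).

Definition tail_equiv (p q : ipath) : Prop :=
  exists m n : nat, [/\ (0 < m)%N, (0 < n)%N & tail m p = tail n q].

Definition icons_fun (e : edge E) (q : ipath) (i : nat) : edge E :=
  if i is j.+1 then q j else e.

Lemma icons_ok (e : edge E) (q : ipath) (h : isrc q = rng e) (i : nat) :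
  rng (icons_fun e q i) = src (icons_fun e q i.+1).
Proof. by case: i => [|i] /=; [rewrite -h|apply: ipath_ok]. Qed.

Definition icons (e : edge E) (q : ipath) (h : isrc q = rng e) : ipath :=
  IPath (icons_ok h).

(* The path e :: c of positive length is closed. *)
Definition closed_path (e : edge E) (c : seq (edge E)) : bool :=
  path (fun f g => rng f == src g) e c && (rng (last e c) == src e).

Definition repeat_fun (e : edge E) (c : seq (edge E)) (i : nat) : edge E :=
  nth e (e :: c) (i %% (size c).+1).

Lemma repeat_ok (e : edge E) (c : seq (edge E)) (h : closed_path e c) i :
  rng (repeat_fun e c i) = src (repeat_fun e c i.+1).
Proof.
case/andP: h => /(pathP e) hc /eqP hl; rewrite /repeat_fun.
have modS : (i.+1 %% (size c).+1 = (i %% (size c).+1).+1 %% (size c).+1)%N.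
  by rewrite -addn1 -modnDml addn1.
have := ltn_pmod i (ltn0Sn (size c)); rewrite ltnS leq_eqVlt => /orP[/eqP h|h].
  by rewrite modS h modnn nth_last.
by rewrite modS (modn_small (_ : _.+1 < _))%N //; apply/eqP/hc.
Qed.

Definition repeat (e : edge E) (c : seq (edge E)) (h : closed_path e c) :=
  IPath (repeat_ok h).

Definition rational (p : ipath) : Prop :=
  exists e c (h : closed_path e c), tail_equiv p (repeat h).

Definition irrational (p : ipath) : Prop := ~ rational p.

Lemma tail_equiv_refl p : tail_equiv p p.
Proof. by exists 1%N, 1%N. Qed.

Lemma tail_equiv_icons p e q (h : isrc q = rng e) :
  tail_equiv p q -> tail_equiv p (icons h).
Proof.
case=> m [n [m0 n0 /ipath_eqP mn]]; exists m, n.+1; split=> //.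
by apply/ipath_eqP => i; rewrite [RHS]/= addnS; apply: mn.
Qed.

Lemma tail_equiv_tail p q : tail_equiv p q -> tail_equiv p (tail 1 q).
Proof.
case=> m [n [m0 n0 /ipath_eqP mn]]; exists m.+1, n; split=> //.
apply/ipath_eqP => i; have /= := mn i.+1.
by rewrite addn1 !addSn addnS.
Qed.

Record tclass (p : ipath) := TClass {
  tclass_val :> ipath;
  tclassP : tail_equiv p tclass_val
}.

HB.instance Definition _ p := gen_eqMixin (tclass p).
HB.instance Definition _ p := gen_choiceMixin (tclass p).

Lemma tclass_eqP p (x y : tclass p) :
  x = y <-> tclass_val x = tclass_val y.
Proof.
split=> [-> //|]; case: x y => [x hx] [y hy] /= xy; subst y.
by congr TClass; apply: Prop_irrelevance.
Qed.

End InfinitePaths.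

Section Chen.
Context (K : fieldType) (E : digraph) (p : ipath E).

(* The K-vector space with basis [p]. *)
Definition chen : Type := {malg K[tclass p]}.

HB.instance Definition _ := GRing.Lmodule.on chen.

Definition chen_basis (q : tclass p) : chen := mkmalgU q 1.

Definition linext (f : tclass p -> chen) (x : chen) : chen :=
  \sum_(q <- msupp x) mcoeff q x *: f q.

Definition vertex_on (v : vertex E) (q : tclass p) : chen :=
  if isrc q == v then chen_basis q else 0.

Definition edge_on (e : edge E) (q : tclass p) : chen :=
  match pselect (isrc q = rng e) with
  | left h => chen_basis (TClass (tail_equiv_icons h (tclassP q)))
  | right _ => 0
  end.

(* q = e q' exactly when e is the first edge of q, and then q' = tail 1 q. *)
Definition ghost_on (e : edge E) (q : tclass p) : chen :=
  if q 0%N == e then chen_basis (TClass (tail_equiv_tail (tclassP q))) else 0.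

Definition gen_on (g : leavitt_gen E) : tclass p -> chen :=
  match g with
  | GVertex v => vertex_on v
  | GEdge e => edge_on e
  | GGhost e => ghost_on e
  end.

Fixpoint term_on (t : nuterm K (leavitt_gen E)) (x : chen) : chen :=
  match t with
  | TGen g => linext (gen_on g) x
  | TZero => 0
  | TAdd t u => term_on t x + term_on u x
  | TOpp t => - term_on t x
  | TScale k t => k *: term_on t x
  | TMul t u => term_on t (term_on u x)
  end.

Lemma linextE f x (d : {fset tclass p}) : (msupp x `<=` d)%fset ->
  linext f x = \sum_(q <- d) mcoeff q x *: f q.
Proof.
move=> /fsubsetP xd; rewrite /linext.
rewrite [RHS](bigID (mem (msupp x))) /= [X in _ + X]big1 ?addr0; last first.
  by move=> q /mcoeff_outdom ->; rewrite scale0r.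
rewrite -[RHS]big_filter; apply: perm_big; apply: uniq_perm.
- exact: fset_uniq.
- by rewrite filter_uniq ?fset_uniq.
by move=> q; rewrite mem_filter; case: (boolP (q \in msupp x)) => // /xd ->.
Qed.

Lemma linext_basis f q : linext f (chen_basis q) = f q.
Proof.
rewrite (@linextE f _ [fset q]%fset); last exact: msuppU_le.
by rewrite big_seq_fset1 mcoeffUU scale1r.
Qed.

Lemma linextD f x y : linext f (x + y) = linext f x + linext f y.
Proof.
rewrite (linextE f (msuppD_le x y)).
rewrite (linextE f (fsubsetUl (msupp x) (msupp y))).
rewrite (linextE f (fsubsetUr (msupp x) (msupp y))).
by rewrite -big_split /=; apply: eq_bigr => q _; rewrite mcoeffD scalerDl.
Qed.

Lemma linextZ f k x : linext f (k *: x) = k *: linext f x.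
Proof.
rewrite (linextE f (msuppZ_le k x)) /linext scaler_sumr.
by apply: eq_bigr => q _; rewrite mcoeffZ scalerA.
Qed.

Lemma term_onD t x y : term_on t (x + y) = term_on t x + term_on t y.
Proof.
elim: t x y => //= [g|| t iht u ihu| t iht| k t iht| t iht u ihu] x y.
- exact: linextD.
- by rewrite addr0.
- by rewrite iht ihu addrACA.
- by rewrite iht opprD.
- by rewrite iht scalerDr.
- by rewrite ihu iht.
Qed.

Lemma term_onZ t k x : term_on t (k *: x) = k *: term_on t x.
Proof.
elim: t x => //= [g|| t iht u ihu| t iht| l t iht| t iht u ihu] x.
- exact: linextZ.
- by rewrite scaler0.
- by rewrite iht ihu scalerDr.
- by rewrite iht scalerN.
- by rewrite iht !scalerA mulrC.
- by rewrite ihu iht.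
Qed.

Lemma term_on_ext t u :
  (forall q, term_on t (chen_basis q) = term_on u (chen_basis q)) ->
  forall x, term_on t x = term_on u x.
Proof.
move=> tu x; have term_on_sum w (s : seq (tclass p)) (F : tclass p -> chen) :
    term_on w (\sum_(q <- s) F q) = \sum_(q <- s) term_on w (F q).
  elim: s => [|q s ih]; last by rewrite !big_cons term_onD ih.
  by rewrite !big_nil -[X in term_on w X](scale0r 0) term_onZ scale0r.
rewrite [x]monalgE !term_on_sum; apply: eq_bigr => q _.
have -> : mkmalgU q (mcoeff q x) = mcoeff q x *: chen_basis q.
  apply/malgP => r.
  by rewrite mcoeffZ !mcoeffU; case: eqP; rewrite ?mulr1 ?mulr0.
by rewrite !term_onZ tu.
Qed.

Lemma vertex_onE v q : linext (vertex_on v) (chen_basis q) =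
  if isrc q == v then chen_basis q else 0.
Proof. exact: linext_basis. Qed.

Lemma linext0 f : linext f 0 = 0.
Proof. by rewrite -[X in linext f X](scale0r 0) linextZ scale0r. Qed.

Lemma edge_on_src e (q : tclass p) (h : isrc q = rng e) :
  edge_on e q = chen_basis (TClass (tail_equiv_icons h (tclassP q))).
Proof.
rewrite /edge_on; case: pselect => [h'|//].
by congr chen_basis; apply/tclass_eqP/ipath_eqP; case.
Qed.

Lemma edge_on_nsrc e (q : tclass p) : isrc q <> rng e -> edge_on e q = 0.
Proof. by rewrite /edge_on; case: pselect. Qed.

Lemma edge_ghost e q : linext (edge_on e) (ghost_on e q) =
  if q 0%N == e then chen_basis q else 0.
Proof.
rewrite /ghost_on; case: eqP => [qe|_]; last exact: linext0.
rewrite linext_basis.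
have h : isrc (tail 1 q) = rng e by rewrite -qe; apply/esym/ipath_ok.
rewrite (edge_on_src (q := TClass _) h); congr chen_basis.
by apply/tclass_eqP/ipath_eqP; case=> [|i] /=; rewrite ?qe ?addn1.
Qed.

Lemma leavitt_rel_on t u (x : chen) :
  leavitt_rel t u -> term_on t x = term_on u x.
Proof.
move=> tu; apply: term_on_ext => q; case: t u / tu => /=.
- move=> v; rewrite !vertex_onE; case: ifP => [h|_]; last exact: linext0.
  by rewrite vertex_onE h.
- move=> v w vw; rewrite vertex_onE; case: eqP => [h|_]; last exact: linext0.
  by rewrite vertex_onE h; case: eqP => // /esym.
- move=> e; rewrite linext_basis.
  have [h|h] := pselect (isrc q = rng e); last first.
    by rewrite edge_on_nsrc // linext0.
  by rewrite (edge_on_src h) vertex_onE /= eqxx.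
- move=> e; rewrite vertex_onE; case: eqP => // h.
  by rewrite linext0 linext_basis edge_on_nsrc.
- move=> e; rewrite linext_basis /ghost_on; case: eqP => [qe|_].
    by rewrite vertex_onE -qe /isrc /= -ipath_ok eqxx.
  exact: linext0.
- move=> e; rewrite vertex_onE linext_basis; case: eqP => h.
    by rewrite linext_basis.
  rewrite linext0 /ghost_on; case: eqP => // qe.
  by case: h; rewrite -qe.
- move=> e; rewrite linext_basis vertex_onE; case: eqP => [h|h].
    rewrite (edge_on_src h) linext_basis /ghost_on /= eqxx.
    congr chen_basis; apply/tclass_eqP/ipath_eqP => i /=.
    by rewrite addn1.
  by rewrite edge_on_nsrc // linext0.
- move=> e f ef; rewrite linext_basis.
  have [h|h] := pselect (isrc q = rng f); last first.
    by rewrite edge_on_nsrc // linext0.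
  rewrite (edge_on_src h) linext_basis /ghost_on /=.
  by case: eqP => // /esym.
- move=> v s [us _ vs]; rewrite vertex_onE.
  have -> : forall y, term_on (tsum [seq TMul (TGen K (GEdge e))
        (TGen K (GGhost e)) | e <- s]) y
      = \sum_(e <- s) linext (edge_on e) (linext (ghost_on e) y).
    by move=> y; elim: (s) => [|e s' ih] /=; rewrite ?big_nil ?big_cons ?ih.
  under eq_bigr => e _ do rewrite linext_basis edge_ghost eq_sym.
  rewrite -big_mkcond /= -big_filter.
  have -> : (isrc q == v) = (q 0%N \in s) by apply/eqP/idP => /vs.
  case: ifP => qs; first by rewrite filter_pred1_uniq // big_seq1.
  rewrite big_filter big_seq_cond big1 // => e /andP[es /eqP eq0].
  by rewrite -eq0 es in qs.
Qed.

Lemma nucongr_on t u (x : chen) :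
  nucongr (@leavitt_rel K E) t u -> term_on t x = term_on u x.
Proof.
move=> tu; elim: {t u} tu x => /=.
- by move=> t u tu x; apply: leavitt_rel_on.
- by [].
- by move=> t u _ ih x; rewrite ih.
- by move=> t u w _ ih1 _ ih2 x; rewrite ih1 ih2.
- by move=> t t' u u' _ ih1 _ ih2 x; rewrite ih1 ih2.
- by move=> t t' _ ih x; rewrite ih.
- by move=> k t t' _ ih x; rewrite ih.
- by move=> t t' u u' _ ih1 _ ih2 x; rewrite ih1 ih2.
- by move=> t u w x; rewrite addrA.
- by move=> t u x; rewrite addrC.
- by move=> t x; rewrite add0r.
- by move=> t x; rewrite addNr.
- by move=> k l t x; rewrite scalerA.
- by move=> t x; rewrite scale1r.
- by move=> k t u x; rewrite scalerDr.
- by move=> k l t x; rewrite scalerDl.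
- by [].
- by [].
- by move=> t u w x; rewrite term_onD.
- by [].
- by move=> k t u x; rewrite term_onZ.
Qed.

Definition chen_act (a : leavitt K E) (x : chen) : chen := term_on (prepr a) x.

Lemma chen_act_pclass t x :
  chen_act (pclass (@leavitt_rel K E) t) x = term_on t x.
Proof. exact/nucongr_on/prepr_pclass. Qed.

Lemma chen_actA a b x :
  chen_act (numul a b) x = chen_act a (chen_act b x).
Proof. exact: chen_act_pclass. Qed.

Lemma chen_actDl a b x : chen_act (a + b) x = chen_act a x + chen_act b x.
Proof. exact: chen_act_pclass. Qed.

Lemma chen_actDr a x y : chen_act a (x + y) = chen_act a x + chen_act a y.
Proof. exact: term_onD. Qed.

Lemma chen_actZl k a x : chen_act (k *: a) x = k *: chen_act a x.
Proof. exact: chen_act_pclass. Qed.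

Lemma chen_actZr k a x : chen_act a (k *: x) = k *: chen_act a x.
Proof. exact: term_onZ. Qed.

HB.instance Definition _ :=
  Lmodule_isNuModule.Build K (leavitt K E) chen
    chen_actA chen_actDl chen_actDr chen_actZl chen_actZr.

Lemma chen_vertex v q : nuact (lvertex K v) (chen_basis q) = vertex_on v q.
Proof. by rewrite [LHS]chen_act_pclass /= linext_basis. Qed.

Lemma chen_edge e q : nuact (ledge K e) (chen_basis q) = edge_on e q.
Proof. by rewrite [LHS]chen_act_pclass /= linext_basis. Qed.

Lemma chen_ghost e q : nuact (lghost K e) (chen_basis q) = ghost_on e q.
Proof. by rewrite [LHS]chen_act_pclass /= linext_basis. Qed.

Definition chen_base : chen := chen_basis (TClass (tail_equiv_refl p)).

End Chen.

(* Main.v *)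
Require Import Defs.
From mathcomp Require Import all_boot all_order all_algebra.
From mathcomp Require Import boolp classical_sets.
From mathcomp Require Import finmap.
From mathcomp.multinomials Require Import monalg.
From mathcomp Require Import zify.

(** Everything rests on one observation ([isolate_basis]): if the path [q] has
nonzero coefficient in [x], then some element of degree 0 of the Leavitt path
algebra sends [x] to the basis vector [q].  Indeed, let [alpha] be the initial
segment of length [n] of [q].  The element [alpha alpha^*] has degree 0 and
fixes the paths that begin with [alpha] and kills the others; since [x] has
finite support, for large [n] the only path in the support that survives is
[q], and it remains to divide by its coefficient.

This has two consequences.

- For any grading of the module, every path [q] is homogeneous
  ([basis_homogeneous]): some homogeneous component of [q] has a nonzero
  coefficient at [q], and an element of degree 0 that sends this component to
  [q] does not change its degree.

- Any nonzero submodule contains some path, hence all paths in the class,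
  because any two of them become equal after deleting initial edges, and edges
  are deleted and restored by ghost edges and edges.  So the module is simple
  ([chen_simple]), and for any grading it is graded-simple.

It remains to see when a grading exists.  A path is rational exactly when two
of its tails at different positions coincide ([rational_tailP]).  If [p] is
rational, let [i < j] be such positions and let [d] be the degree of [p] in
some grading.  Deleting the first edge lowers the degree by 1, so the common
tail would be homogeneous of both degrees [d - i] and [d - j], which is absurd
([graded_irrational]).  If [p] is irrational, give [q] the degree [i - j]
whenever deleting [i] edges of [q] and [j] edges of [p] leaves the same path;
irrationality makes this well defined, and it is a grading
([degree_grading]). *)

Set Implicit Arguments.
Unset Strict Implicit.
Unset Printing Implicit Defensive.

Import GRing.Theory.
Local Open Scope classical_set_scope.
Local Open Scope ring_scope.

(** * Tails of paths and rationality *)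

Section Paths.
Context (E : digraph).
Implicit Types p q r : ipath E.

Lemma tail_tail m n q : tail m (tail n q) = tail (m + n) q.
Proof. by apply/ipath_eqP => i /=; rewrite addnA. Qed.

Lemma tail0 q : tail 0 q = q.
Proof. by apply/ipath_eqP => i /=; rewrite addn0. Qed.

Lemma tail_icons e q (h : isrc q = rng e) : tail 1 (icons h) = q.
Proof. by apply/ipath_eqP => i /=; rewrite addn1. Qed.

Lemma ipath_periodic p k i : tail k p = p -> p (i %% k)%N = p i.
Proof.
move=> /ipath_eqP pk; have {}pk l : p (l + k) = p l := pk l.
rewrite {2}(divn_eq i k) addnC; elim: (i %/ k)%N => [|m ih].
  by rewrite addn0.
by rewrite mulSn addnCA addnC pk.
Qed.

(** If the tails at positions [i < j] agree, the tail at [i] is periodic of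
period [j - i], and its first [j - i] edges form the closed path. *)
Lemma rational_tailP p :
  rational p <-> exists i j, (i < j)%N /\ tail i p = tail j p.
Proof.
split=> [[e [c [h [m [n [_ _ mn]]]]]]|[i [j [ij pij]]]].
  exists m, ((size c).+1 + m)%N; split; first by rewrite addSn ltnS leq_addl.
  rewrite -tail_tail mn tail_tail; apply/ipath_eqP => i /=.
  by rewrite /repeat_fun [(i + (_ + n))%N]addnCA modnDl.
have [k kE] : exists k, (j = k.+1 + i)%N by exists (j - i).-1; lia.
set q := tail i p; have qk : tail k.+1 q = q by rewrite tail_tail -kE.
pose c := mkseq (fun l => q l.+1) k.
have qE l : (l < k.+1)%N -> nth (q 0) (q 0 :: c) l = q l.
  by case: l => [//|l] /= lk; rewrite nth_mkseq.
have szc : size c = k by rewrite size_mkseq.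
have h : closed_path (q 0) c.
  apply/andP; split.
    apply/(pathP (q 0)) => l; rewrite szc => lk.
    rewrite qE ?ltnS 1?ltnW // nth_mkseq //; apply/eqP; exact: ipath_ok.
  (* The path closes up since edge [k.+1] of [q] is edge [0] again. *)
  have -> : last (q 0) c = q k by rewrite (last_nth (q 0)) szc qE.
  by rewrite ipath_ok; apply/eqP; rewrite -[in RHS]qk.
(* Both positions are shifted by a full period [k.+1], because
   tail-equivalence asks for positive positions. *)
exists (q 0), c, h, (k.+1 + i)%N, k.+1; split; [lia|by []|].
rewrite -tail_tail; apply/ipath_eqP => l.
by rewrite [RHS]/= /repeat_fun szc qE ?ltn_pmod // ipath_periodic.
Qed.

End Paths.

(** * Coordinates in the Chen module *)

Section ChenModule.
Context (K : fieldType) (E : digraph) (p : ipath E).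
Implicit Types (q r : tclass p) (x : chen K p).
Local Notation basis := (chen_basis K).

Lemma chen_coef0 q : mcoeff q (0 : chen K p) = 0.
Proof. exact: mcoeff0. Qed.

Lemma chen_coefD q x y : mcoeff q (x + y) = mcoeff q x + mcoeff q y.
Proof. exact: mcoeffD. Qed.

Lemma chen_coefZ q k x : mcoeff q (k *: x) = k * mcoeff q x.
Proof. exact: mcoeffZ. Qed.

Lemma chen_coef_sum q (I : Type) (s : seq I) (F : I -> chen K p) :
  mcoeff q (\sum_(i <- s) F i) = \sum_(i <- s) mcoeff q (F i).
Proof.
elim: s => [|i s ih]; first by rewrite !big_nil chen_coef0.
by rewrite !big_cons chen_coefD ih.
Qed.

Lemma chen_coef_basis q r : mcoeff r (basis q) = (q == r)%:R.
Proof. by rewrite mcoeffU. Qed.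

Lemma basis_neq0 q : basis q <> 0.
Proof.
move=> /(congr1 (mcoeff q)); rewrite chen_coef_basis chen_coef0 eqxx.
by move/eqP; rewrite oner_eq0.
Qed.

Lemma chen_expand x : x = \sum_(q <- msupp x) mcoeff q x *: basis q.
Proof.
rewrite [LHS]monalgE; apply: eq_bigr => q _.
apply/malgP => r; rewrite chen_coefZ !mcoeffU.
by case: eqP; rewrite ?mulr1 ?mulr0.
Qed.

Lemma nuact0 (a : leavitt K E) : nuact a (0 : chen K p) = 0.
Proof. by apply: (addIr (nuact a 0)); rewrite -nuactDr !add0r. Qed.

Lemma nuact_linext (a : leavitt K E) x :
  nuact a x = linext (fun q => nuact a (basis q)) x.
Proof.
rewrite {1}(chen_expand x) /linext.
elim: (enum_fset _) => [|q s ih]; first by rewrite !big_nil nuact0.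
by rewrite !big_cons nuactDr ih nuactZr.
Qed.

Lemma chen_coef_linext f x r :
  mcoeff r (linext f x) = \sum_(q <- msupp x) mcoeff q x * mcoeff r (f q).
Proof.
by rewrite /linext chen_coef_sum; apply: eq_bigr => q _; rewrite chen_coefZ.
Qed.

(** * Isolating a basis vector *)

(** For the initial segment [alpha] of length [n] of [q], this is the
idempotent [alpha alpha^*], with the source of [q] standing for the empty
path. *)
Fixpoint cylinder (n : nat) (q : ipath E) : leavitt K E :=
  if n is m.+1 then
    numul (ledge K (q 0)) (numul (cylinder m (tail 1 q)) (lghost K (q 0)))
  else lvertex K (isrc q).

Lemma cylinder_deg0 n (q : ipath E) : leavitt_grading K E 0 (cylinder n q).
Proof.
elim: n q => [|n ih] q /=.
  exact: (homog_gen _ _ (GVertex (isrc q))).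
rewrite -[0 : int]/(1 + (0 + -1) : int).
apply: homog_mul; first exact: (homog_gen _ _ (GEdge (q 0))).
apply: homog_mul; first exact: ih.
exact: (homog_gen _ _ (GGhost (q 0))).
Qed.

Lemma nuact_ledge e x : nuact (ledge K e) x = linext (edge_on K e) x.
Proof. exact: chen_act_pclass. Qed.

Lemma cylinder_id n (q : ipath E) r :
  tclass_val r = q -> nuact (cylinder n q) (basis r) = basis r.
Proof.
elim: n q r => [|n ih] _ r <- /=.
  by rewrite chen_vertex /vertex_on eqxx.
rewrite !nuactA chen_ghost.
have := edge_ghost K (r 0) r; rewrite /ghost_on eqxx => <-.
by rewrite ih // nuact_ledge.
Qed.

Lemma cylinder_kill n (q : ipath E) r i :
  (i < n)%N -> r i <> q i -> nuact (cylinder n q) (basis r) = 0.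
Proof.
elim: n q r i => [//|n ih] q r i /= lin rqi.
rewrite !nuactA chen_ghost /ghost_on.
case: eqP => [rq|_]; last by rewrite !nuact0.
case: i lin rqi => [//|i] lin rqi.
by rewrite (ih _ _ i) ?nuact0 //= addn1.
Qed.

Lemma separating_length q (s : seq (tclass p)) :
  exists n, forall r, r \in s -> r <> q -> exists2 i, (i < n)%N & r i <> q i.
Proof.
elim: s => [|r s [n ih]]; first by exists 0%N.
have [->|rq] := pselect (r = q).
  by exists n => t; rewrite inE => /predU1P[->//|]; apply: ih.
have [i ri] : exists i, r i <> q i.
  by apply/existsNP => rqi; apply/rq/tclass_eqP/ipath_eqP.
exists (maxn n i.+1) => t; rewrite inE => /predU1P[-> _|ts tq].
  by exists i => //; rewrite leq_max leqnn orbT.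
by have [j jn tj] := ih t ts tq; exists j => //; rewrite leq_max jn.
Qed.

(** A cylinder long enough to separate [q] from the rest of the finite support
of [x] maps [x] to a multiple of [q]. *)
Lemma isolate_basis x q : mcoeff q x != 0 ->
  exists2 a, leavitt_grading K E 0 a & nuact a x = basis q.
Proof.
move=> xq; have [n sep] := separating_length q (msupp x).
exists ((mcoeff q x)^-1 *: cylinder n q).
  exact/homog_scale/cylinder_deg0.
rewrite nuactZl nuact_linext /linext (bigD1_seq q) ?fset_uniq -?mcoeff_neq0 //=.
rewrite cylinder_id // big_seq_cond big1 ?addr0 ?scalerA ?mulVf ?scale1r //.
move=> r /andP[rx /eqP rq]; have [i lin ri] := sep r rx rq.
by rewrite (cylinder_kill lin ri) scaler0.
Qed.

Lemma chen_neq0 x : x <> 0 -> exists q, mcoeff q x != 0.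
Proof.
move=> x0; apply: contrapT => /forallNP xq; apply: x0; apply/malgP => q.
by rewrite chen_coef0; apply/eqP; apply/negPn/negP/xq.
Qed.

(** * Simplicity *)

Definition btail q : tclass p := TClass (tail_equiv_tail (tclassP q)).

Lemma ghost_tail q : nuact (lghost K (q 0%N)) (basis q) = basis (btail q).
Proof. by rewrite chen_ghost /ghost_on eqxx. Qed.

Lemma edge_tail q : nuact (ledge K (q 0%N)) (basis (btail q)) = basis q.
Proof.
by have := edge_ghost K (q 0) q; rewrite nuact_ledge /ghost_on !eqxx.
Qed.

Lemma iter_btail n q : iter n btail q = tail n q :> ipath E.
Proof.
elim: n => [|n ih] /=; first by rewrite tail0.
by rewrite ih tail_tail.
Qed.

Lemma submodule_btail (N : set (chen K p)) n q : is_submodule N ->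
  N (basis q) <-> N (basis (iter n btail q)).
Proof.
move=> [_ Nact]; elim: n => [//|n ih] /=; rewrite ih.
by split=> Nq; [rewrite -ghost_tail|rewrite -edge_tail]; apply: Nact.
Qed.

Lemma tclass_tails q r : exists m n, iter m btail q = iter n btail r.
Proof.
have [i [j [_ _ ij]]] := tclassP q; have [k [l [_ _ kl]]] := tclassP r.
exists (k + j)%N, (i + l)%N; apply/tclass_eqP.
by rewrite !iter_btail -!tail_tail -ij -kl !tail_tail addnC.
Qed.

(** A nonzero submodule contains one path by [isolate_basis], then the common
tail of this path with any other path, then every path.  It is closed under
scalars because [k *: r] is the image of [r] under [k *: v], where [v] is the
source of [r]. *)
Lemma chen_simple (N : set (chen K p)) :
  is_submodule N -> N = [set 0] \/ N = setT.
Proof.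
move=> Nsub; have [[N0 NB] Nact] := Nsub.
have [Ntriv|/existsNP[x /not_implyP[Nx x0]]] :=
  pselect (forall x, N x -> x = 0).
  by left; apply/seteqP; split=> [x /Ntriv //|x ->].
right; apply/seteqP; split=> // y _.
have [q xq] := chen_neq0 x0; have [a _ ax] := isolate_basis xq.
have Nq : N (basis q) by rewrite -ax; apply: Nact.
have Nbasis r : N (basis r).
  have [m [n mn]] := tclass_tails q r.
  apply/(submodule_btail n r Nsub); rewrite -mn.
  exact/(submodule_btail m q Nsub).
have ND u v : N u -> N v -> N (u + v).
  move=> Nu Nv; rewrite -[v]opprK; apply: (NB _ _ Nu).
  by rewrite -sub0r; apply: NB.
rewrite (chen_expand y); elim: (enum_fset _) => [|r s ih].
  by rewrite big_nil.
rewrite big_cons; apply: ND ih.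
have <- : nuact (mcoeff r y *: lvertex K (isrc r)) (basis r)
    = mcoeff r y *: basis r.
  by rewrite nuactZl chen_vertex /vertex_on eqxx.
exact: Nact.
Qed.

(** * Consequences of the existence of a grading *)

Section AnyGrading.
Context (M : int -> set (chen K p)).
Hypothesis gradM : module_grading (leavitt_grading K E) M.

(** Some homogeneous component of [q] has a nonzero coefficient at [q]; an
element of degree 0 turns it into [q] within the same degree. *)
Lemma basis_homogeneous q : homogeneous M (basis q).
Proof.
have [[_ dec _] act] := gradM.
have [s [c [Mc qE]]] := dec (basis q) I.
have [n cn] : exists n, mcoeff q (c n) != 0.
  apply: contrapT => /forallNP cq0.
  have := chen_coef_basis q q; rewrite qE chen_coef_sum big1 => [|n _].
    by rewrite eqxx => /eqP; rewrite eq_sym oner_eq0.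
  by apply/eqP/negPn/negP/cq0.
have [a a0 ac] := isolate_basis cn.
by exists n; rewrite -ac -[X in M X]add0r; apply: act.
Qed.

Lemma homogeneous_unique m n x : M m x -> M n x -> m <> n -> x = 0.
Proof.
move=> Mm Mn mn; have [[sub _ indep] _] := gradM.
have sub0 k : M k 0 by have [[]] := sub k.
have Nn : M n (- x) by rewrite -sub0r; have [[_ subB] _] := sub n; apply: subB.
pose c k : chen K p := if k == m then x else if k == n then - x else 0.
have := indep [:: m; n] c; rewrite /c => /(_ _ _ _ m); rewrite eqxx; apply.
- by rewrite /= inE; apply/andP; split=> //; apply/eqP.
- by move=> k; case: eqP => [->//|_]; case: eqP => [->|_].
- rewrite !big_cons big_nil !eqxx; case: eqP => [/esym //|_].
  by rewrite addr0 subrr.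
- by rewrite inE eqxx.
Qed.

Lemma iter_btail_deg n q d :
  M d (basis q) -> M (d - n%:Z) (basis (iter n btail q)).
Proof.
have [_ act] := gradM.
move=> Mq; elim: n => [|n ih] /=; first by rewrite subr0.
rewrite -ghost_tail (_ : d - n.+1%:Z = -1 + (d - n%:Z)); last by lia.
by apply: act ih; apply: (homog_gen _ _ (GGhost _)).
Qed.

(** Two equal tails of [p] at different positions would be one nonzero vector
with two different degrees. *)
Lemma graded_irrational : irrational p.
Proof.
move=> /rational_tailP[i [j [ij pij]]].
pose b := TClass (tail_equiv_refl p).
have [d Md] := basis_homogeneous b.
have tE : iter i btail b = iter j btail b.
  by apply/tclass_eqP; rewrite !iter_btail.
apply: (@basis_neq0 (iter j btail b)).
apply: (@homogeneous_unique (d - i%:Z) (d - j%:Z)); last by lia.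
  by rewrite -tE; apply: iter_btail_deg.
exact: iter_btail_deg.
Qed.

End AnyGrading.

(** * The grading for an irrational path *)

Section DegreeGrading.
Hypothesis irr : irrational p.

Definition tail_deg (q : ipath E) (n : int) : Prop :=
  exists i j : nat, tail i q = tail j p /\ n = i%:Z - j%:Z.

Lemma tail_deg_exists q : exists n, tail_deg q n.
Proof.
by have [j [i [_ _ ij]]] := tclassP q; exists (i%:Z - j%:Z), i, j.
Qed.

(** Two degrees of the same [q] give two positions at which [p] has the same
tail; irrationality forces these positions to be equal. *)
Lemma tail_deg_unique (q : ipath E) m n : tail_deg q m -> tail_deg q n -> m = n.
Proof.
move=> [i [j [qij ->]]] [k [l [qkl ->]]].
have tE : tail (k + j) p = tail (i + l) p.
  by rewrite -!tail_tail -qij -qkl !tail_tail addnC.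
have [lt|lt|kjil] := ltngtP (k + j)%N (i + l)%N; last by lia.
- by case: irr; apply/rational_tailP; exists (k + j)%N, (i + l)%N.
- by case: irr; apply/rational_tailP; exists (i + l)%N, (k + j)%N.
Qed.

Lemma tail_deg_cons (q r : ipath E) n :
  tail 1 r = q -> tail_deg q n <-> tail_deg r (n + 1).
Proof.
move=> <-; split=> [[i [j [ij nE]]]|[i [j [ij nE]]]].
  by exists (i + 1)%N, j; rewrite -tail_tail ij; split=> //; lia.
exists i, (j + 1)%N; split; last by lia.
by rewrite tail_tail addnC -tail_tail ij tail_tail addnC.
Qed.

Lemma gen_on_deg g q r n : mcoeff r (gen_on K g q) != 0 ->
  tail_deg q n -> tail_deg r (leavitt_deg g + n).
Proof.
have basis_neq t : mcoeff r (basis t) != 0 -> t = r.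
  by rewrite chen_coef_basis; case: (t =P r) => // _; rewrite eqxx.
case: g => [v|e|e] /=.
- rewrite /vertex_on add0r; case: ifP => _; last by rewrite chen_coef0 eqxx.
  by move=> /basis_neq ->.
- have [h|h] := pselect (isrc q = rng e); last first.
    by rewrite edge_on_nsrc // chen_coef0 eqxx.
  rewrite (edge_on_src K h) addrC => /basis_neq <- /=.
  by move/(tail_deg_cons _ (tail_icons h)).
- rewrite /ghost_on; case: ifP => _; last by rewrite chen_coef0 eqxx.
  move=> /basis_neq <- qn; apply/(@tail_deg_cons _ q) => //.
  by rewrite addrAC addNr add0r.
Qed.

Definition degree_part (n : int) : set (chen K p) :=
  [set x | forall q, mcoeff q x != 0 -> tail_deg q n].

Lemma degree_part0 n : degree_part n 0.
Proof. by move=> q; rewrite chen_coef0 eqxx. Qed.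

Lemma degree_partD n x y :
  degree_part n x -> degree_part n y -> degree_part n (x + y).
Proof.
move=> Mx My q; rewrite chen_coefD; have [->|xq _] := eqVneq (mcoeff q x) 0.
  by rewrite add0r; apply: My.
exact: Mx.
Qed.

Lemma degree_partZ n k x : degree_part n x -> degree_part n (k *: x).
Proof.
by move=> Mx q; rewrite chen_coefZ mulf_eq0 negb_or => /andP[_]; apply: Mx.
Qed.

(** The generators suffice, as a homogeneous element is built from them by
products, sums and scalars: each generator sends a path to 0 or to a path whose
degree is shifted by the degree of the generator. *)
Lemma degree_part_act m n a x : leavitt_grading K E m a ->
  degree_part n x -> degree_part (m + n) (nuact a x).
Proof.
move=> am; elim: am n x =>
  {m a} [g|m l a b _ iha _ ihb|m|m a b _ iha _ ihb|m k a _ iha] n x Mx.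
- have -> : nuact (pgen (leavitt_rel (E:=E)) g : leavitt K E) x
      = linext (gen_on K g) x.
    exact: chen_act_pclass.
  move=> r; rewrite chen_coef_linext => rn.
  have [q /andP[xq gq]] : exists q,
      (mcoeff q x != 0) && (mcoeff r (gen_on K g q) != 0).
    apply: contrapT => /forallNP nq; move: rn; rewrite big1 ?eqxx // => q _.
    apply/eqP; rewrite mulf_eq0; apply/negPn/negP.
    by rewrite negb_or; apply: nq.
  exact: gen_on_deg gq (Mx q xq).
- have -> : nuact (numul a b : leavitt K E) x
      = nuact (a : leavitt K E) (nuact (b : leavitt K E) x).
    exact: nuactA.
  by rewrite -addrA; apply/iha/ihb.
- rewrite -[X in nuact X](scale0r (0 : leavitt K E)) nuactZl scale0r.
  exact: degree_part0.
- by rewrite nuactDl; apply: degree_partD; [apply: iha|apply: ihb].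
- by rewrite nuactZl; apply/degree_partZ/iha.
Qed.

Lemma degree_grading : module_grading (leavitt_grading K E) degree_part.
Proof.
split; last by move=> m n a x; apply: degree_part_act.
split.
- move=> n; split=> //; split; first exact: degree_part0.
  move=> x y Mx My; apply: degree_partD => //.
  by rewrite -scaleN1r; apply: degree_partZ.
- move=> x _.
  pose deg q := projT1 (cid (tail_deg_exists q)).
  have degP q : tail_deg q (deg q) by rewrite /deg; case: cid.
  (* The component of degree [n] keeps the terms of [x] whose path has degree
     [n]. *)
  pose c n := linext (fun q => if deg q == n then basis q else 0) x.
  have cE n r : mcoeff r (c n) = if deg r == n then mcoeff r x else 0.
    rewrite /c (linextE _ (fsubsetUl (msupp x) [fset r]%fset)).
    rewrite chen_coef_sum (bigD1_seq r) ?fset_uniq ?inE ?eqxx ?orbT //=.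
    rewrite chen_coefZ big1 ?addr0 => [|q qr].
      case: ifP => _; rewrite ?chen_coef0 ?mulr0 //.
      by rewrite chen_coef_basis eqxx mulr1.
    rewrite chen_coefZ; case: ifP => _; rewrite ?chen_coef0 ?mulr0 //.
    by rewrite chen_coef_basis (negPf qr) mulr0.
  exists (undup [seq deg q | q <- msupp x]), c; split.
    move=> n q; rewrite cE; case: (deg q =P n) => [<- _|_]; first exact: degP.
    by rewrite eqxx.
  apply/malgP => r; rewrite chen_coef_sum /=.
  under eq_bigr => n _ do rewrite cE.
  have [->|xr] := eqVneq (mcoeff r x) 0.
    by rewrite big1 // => n _; case: ifP.
  rewrite (bigD1_seq (deg r)) ?undup_uniq ?mem_undup ?map_f -?mcoeff_neq0 //=.
  rewrite eqxx big1 ?addr0 // => n; rewrite eq_sym; by case: eqP.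
- move=> s c us Mc c0 n ns; apply/malgP => r; rewrite chen_coef0.
  apply/eqP/negPn/negP => cr; have rn := Mc n r cr.
  have := congr1 (mcoeff r) c0; rewrite chen_coef0 chen_coef_sum.
  rewrite (bigD1_seq n) //=.
  rewrite big1 ?addr0 => [/eqP|m mn]; first by rewrite (negPf cr).
  apply/eqP/negPn/negP => /(Mc m r)/(tail_deg_unique rn) mE.
  by rewrite mE eqxx in mn.
Qed.

End DegreeGrading.

End ChenModule.

Theorem proposition3p6 (K : fieldType) (E : digraph) (p : ipath E) :
  ((exists M : int -> set (chen K p), graded_simple (leavitt_grading K E) M)
     <-> irrational p)
  /\ (irrational p ->
      forall M : int -> set (chen K p),
        graded_simple (leavitt_grading K E) M ->
        homogeneous M (chen_base K p)).
Proof.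
split; last by move=> _ M [gradM _]; apply: basis_homogeneous gradM _.
split=> [[M [gradM _]]|irr]; first exact: graded_irrational gradM.
exists (@degree_part K E p); split; first exact: degree_grading.
by move=> N [Nsub _]; apply: chen_simple.
Qed.
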